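(* Let $(X,P)$ and $(Y,Q)$ be topological-measure pairs such that $(X,P)$ embeds in $(Y,Q)$. Then $\dim(X,P)\le \dim(Y,Q)$. In particular, $\dim(X,P)$ is an invariant of isomorphism in the category of topological-measure pairs: if $(X,P)$ and $(Y,Q)$ are isomorphic topological-measure pairs, then $\dim(X,P)=\dim(Y,Q)$.
   Context: For a compact metric space $X$, $\mathrm{Prob}(X)$ denotes the set of Borel probability measures on $X$ with the weak-$*$ topology. A topological-measure pair is a pair $(X,P)$ where $X$ is a compact metric space and $P\subseteq \mathrm{Prob}(X)$ is a closed convex subset. A morphism from $(X,P)$ to $(Y,Q)$ is a continuous map $f:X\to Y$ such that the push-forward map $f_*:\mathrm{Prob}(X)\to\mathrm{Prob}(Y)$ satisfies $f_*(P)\subseteq Q$. An embedding of $(X,P)$ into $(Y,Q)$ is a morphism $f:X\to Y$ that is also a topological embedding of $X$ into $Y$. An isomorphism is a morphism $f$ that is a homeomorphism $X\to Y$ with $f_*(P)=Q$. $\mathrm{Cov}(X)$ is the set of finite open covers of $X$. For collections $\mathcal{V},\mathcal{U}$ of subsets of $X$, $\mathcal{V}\succeq\mathcal{U}$ ($\mathcal V$ refines $\mathcal U$) means that every $V\in\mathcal{V}$ is contained in some $U\in\mathcal{U}$. For a finite collection $\mathcal{V}$ of Borel subsets of $X$ and $x\in X$, $\mathrm{ord}(\mathcal{V},x)=-1+\sum_{V\in\mathcal{V}}\mathbf{1}_V(x)$. For $P\neq\emptyset$, put $\mathrm{ord}(\mathcal{V},P)=\sup_{\mu\in P}\int_X \mathrm{ord}(\mathcal{V},x)\,d\mu(x)$;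 for $\mathcal{U}\in\mathrm{Cov}(X)$, $\dim(\mathcal{U},P)=\inf\{\mathrm{ord}(\mathcal{V},P):\mathcal{V}\in\mathrm{Cov}(X),\ \mathcal{V}\succeq\mathcal{U}\}$; and $\dim(X,P)=\sup_{\mathcal{U}\in\mathrm{Cov}(X)}\dim(\mathcal{U},P)\in[0,+\infty]$. If $P=\emptyset$, then $\dim(X,P)=-\infty$ by convention. *)

(* Defs.v *)
From HB Require Import structures.
From mathcomp Require Import all_boot all_order all_algebra.
From mathcomp Require Import all_classical all_reals all_analysis.

Set Implicit Arguments.
Unset Strict Implicit.
Unset Printing Implicit Defensive.
Import Order.TTheory GRing.Theory Num.Theory.
Import numFieldTopology.Exports numFieldNormedType.Exports.
Local Open Scope classical_set_scope.
Local Open Scope ring_scope.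

(* MathComp-Analysis requires the carrier of a measurable type to be pointed,
   whereas a compact metric space may be empty.  Borel sets are therefore put
   on X relative to a (proof-irrelevant) witness [h] that X is inhabited;
   neither the measurable sets nor the integral depend on [h]. *)
Definition inhabited_copy (X : topologicalType) (h : $|X|) : Type := X.

HB.instance Definition _ (X : topologicalType) (h : $|X|) :=
  Choice.on (inhabited_copy h).
HB.instance Definition _ (X : topologicalType) (h : $|X|) :=
  isPointed.Build (inhabited_copy h) (unsquash h).

Definition borel (X : topologicalType) (h : $|X|) :=
  g_sigma_algebraType (@open X : set (set (inhabited_copy h))).

(* The first field is no restriction: the empty space carries no
   probability measure. *)
Record Prob (R : realType) (X : topologicalType) := MkProb {
  prob_inh : $|X| ;
  law : probability (borel prob_inh) R
}.

HB.instance Definition _ (R : realType) (X : topologicalType) :=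
  gen_eqMixin (Prob R X).
HB.instance Definition _ (R : realType) (X : topologicalType) :=
  gen_choiceMixin (Prob R X).

Definition integrate_cts (R : realType) (X : topologicalType) (mu : Prob R X) :
    {ptws continuousType X R -> R} :=
  fun f => \int[law mu]_x f x.

(* The weak-* topology: the coarsest one making mu |-> \int f dmu continuous
   for every continuous f : X -> R.  Library measures are functions on all
   subsets, so two elements of [Prob R X] may agree on Borel sets and yet be
   different; they are then indistinguishable for this topology, so a closed
   set contains both or neither. *)
HB.instance Definition _ (R : realType) (X : topologicalType) :=
  Topological.copy (Prob R X) (initial_topology (@integrate_cts R X)).

Section pushforward.
Context (R : realType) (X Y : topologicalType) (f : continuousType X Y).

Definition borel_map (h : $|X|) (k : $|Y|) : borel h -> borel k := f.

Lemma borel_map_measurable h k : measurable_fun [set: borel h] (@borel_map h k).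
Proof.
apply: (@measurability _ _ (borel h) (borel k) _ _ (@open Y)) => //.
move=> _ [B oB <-]; rewrite setTI; apply: sub_sigma_algebra.
by apply: open_comp => // x _; exact: cts_fun.
Qed.

HB.instance Definition _ h k :=
  isMeasurableFun.Build _ _ (borel h) (borel k) (@borel_map h k)
    (@borel_map_measurable h k).

Definition push_inh (h : $|X|) : $|Y| := squash (f (unsquash h)).

Definition push (mu : Prob R X) : Prob R Y :=
  MkProb (distribution (law mu)
            (@borel_map (prob_inh mu) (push_inh (prob_inh mu)))).

End pushforward.

Section mixture.
Context (R : realType) (X : topologicalType).

Section change_witness.
Context (h : $|X|) (mu : Prob R X).

(* [law mu], transported to the witness [h] *)
Definition law_at (A : set (borel h)) : \bar R := law mu A.

Lemma law_at0 : law_at set0 = 0%E.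
Proof. exact: (measure0 (law mu)). Qed.

Lemma law_at_ge0 A : (0 <= law_at A)%E.
Proof. exact: (measure_ge0 (law mu)). Qed.

Lemma law_at_sigma_additive : semi_sigma_additive law_at.
Proof. exact: (@measure_semi_sigma_additive _ _ _ (law mu)). Qed.

HB.instance Definition _ := isMeasure.Build _ (borel h) R law_at
  law_at0 law_at_ge0 law_at_sigma_additive.

End change_witness.

Context (t : {i01 R}) (mu nu : Prob R X).

Definition mix_law : set (borel (prob_inh mu)) -> \bar R :=
  measure_add (mscale t%:num%:nng (law mu))
    (mscale (1 - t%:num)%:nng (@law_at (prob_inh mu) nu)).

HB.instance Definition _ := Measure.on mix_law.

Lemma mix_law_setT : mix_law setT = 1%:E.
Proof.
rewrite /mix_law measure_addE /= /mscale /= /law_at !probability_setT.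
by rewrite !mule1 -EFinD addrC subrK.
Qed.

HB.instance Definition _ :=
  Measure_isProbability.Build _ _ _ mix_law mix_law_setT.

Definition mix : Prob R X := MkProb mix_law.

Lemma mixE (A : set X) : law mix A =
  (t%:num%:E * law mu A + (1 - t%:num)%:E * law nu A)%E.
Proof. by rewrite /= /mix_law measure_addE. Qed.

End mixture.

Definition convex_prob (R : realType) (X : topologicalType)
    (P : set (Prob R X)) : Prop :=
  forall (t : {i01 R}) mu nu, P mu -> P nu -> P (mix t mu nu).

Record tmpair (R : realType) := TMPair {
  tm_space :> metricType R ;
  tm_compact : compact [set: tm_space] ;
  tm_prob : set (Prob R tm_space) ;
  tm_closed : closed tm_prob ;
  tm_convex : convex_prob tm_prob
}.
Arguments tm_prob {R} _.

Section morphisms.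
Context (R : realType).
Implicit Types X Y : tmpair R.

Definition tm_morphism X Y (f : continuousType X Y) : Prop :=
  push f @` tm_prob X `<=` tm_prob Y.

Definition topological_embedding (S T : topologicalType) (f : S -> T) : Prop :=
  [/\ injective f, continuous f &
      forall A : set S, open A ->
        exists2 B : set T, open B & f @` A = B `&` range f].

Definition tm_embedding X Y (f : continuousType X Y) : Prop :=
  tm_morphism f /\ topological_embedding f.

Definition homeomorphism (S T : topologicalType) (f : S -> T) : Prop :=
  continuous f /\
  exists g : T -> S, [/\ continuous g, cancel f g & cancel g f].

Definition tm_isomorphism X Y (f : continuousType X Y) : Prop :=
  [/\ tm_morphism f, homeomorphism f & push f @` tm_prob X = tm_prob Y].

Definition tm_embeds X Y : Prop :=
  exists f : continuousType X Y, tm_embedding f.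

Definition tm_isomorphic X Y : Prop :=
  exists f : continuousType X Y, tm_isomorphism f.

End morphisms.

Section dimension.
Context (R : realType).

Definition Cov (X : topologicalType) : set (set (set X)) :=
  [set U | [/\ finite_set U, U `<=` open & \bigcup_(A in U) A = setT]].

Definition refines (X : Type) (V U : set (set X)) : Prop :=
  forall A, V A -> exists2 B, U B & A `<=` B.

Definition ord_at (X : Type) (V : set (set X)) (x : X) : R :=
  -1 + \sum_(A \in V) (\1_A x : R).

Definition ord_prob (X : topologicalType) (V : set (set X))
    (P : set (Prob R X)) : \bar R :=
  ereal_sup [set (\int[law mu]_x (ord_at V x)%:E)%E | mu in P].

Definition dim_cover (X : topologicalType) (U : set (set X))
    (P : set (Prob R X)) : \bar R :=
  ereal_inf [set ord_prob V P | V in [set V | Cov V /\ refines V U]].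

Definition tm_dim (X : tmpair R) : \bar R :=
  if tm_prob X == set0 then -oo%E
  else ereal_sup [set dim_cover U (tm_prob X) | U in @Cov X].

End dimension.

(* Main.v *)
Require Import Defs.
From HB Require Import structures.
From mathcomp Require Import all_boot all_order all_algebra.
From mathcomp Require Import finmap.
From mathcomp Require Import all_classical all_reals all_analysis.
From mathcomp Require Import measurable_realfun.

(** An embedding [f : X -> Y] lets finite open covers travel both ways.

    Given a cover [U] of [X], each [A \in U] is the trace on [f(X)] of some
    open [B] of [Y]; these [B], together with the complement of [f(X)] (open,
    because [f(X)] is compact in a Hausdorff space), form a cover [W] of [Y].
    If [V] is a finite open cover of [Y] refining [W], its pullback
    [f^-1 V] is a finite open cover of [X] which refines [U]: injectivity
    gives [f^-1 B = A], and a member of [V] contained in the complement of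
    [f(X)] pulls back to the empty set ([extend_cover]).

    Pulling back cannot increase the order: distinct members of [V] may have
    the same preimage, but none is created ([ord_at_preimage_le]).
    Integrating this pointwise bound against [mu \in P] and changing variables
    bounds the order of the pullback by the integral of the order of [V]
    against [f_* mu], which lies in [Q] ([ord_prob_preimage_le]).  Taking the
    infimum over [V] and the supremum over [U] gives [dim X <= dim Y].

    For isomorphic pairs the inequality applies to [f] and to its inverse [g];
    the latter is a morphism because [g_* f_* mu = mu] and [Q = f_* P]. *)

Set Implicit Arguments.
Unset Strict Implicit.
Unset Printing Implicit Defensive.
Import Order.TTheory GRing.Theory Num.Theory.
Local Open Scope classical_set_scope.
Local Open Scope ring_scope.

(** The remaining components of a probability are proofs, hence irrelevant. *)
Lemma probability_ext d (T : measurableType d) (R : realType)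
    (mu nu : probability T R) :
  mu = nu :> (set T -> \bar R) -> mu = nu.
Proof.
case: mu nu => [mu [p1 p2 p3 p4 p5 p6 p7]] [nu [q1 q2 q3 q4 q5 q6 q7]] /= munu.
subst nu; congr Probability.Pack.
case: p1 p2 => [a1 a2] [a3]; case: q1 q2 => [b1 b2] [b3].
rewrite (Prop_irrelevance b1 a1) (Prop_irrelevance b2 a2).
rewrite (Prop_irrelevance b3 a3).
case: p3 p4 p5 p6 p7 => [a4] [a5] [a6] [a7] [a8].
case: q3 q4 q5 q6 q7 => [b4] [b5] [b6] [b7] [b8].
by congr Probability.Class; f_equal; exact: Prop_irrelevance.
Qed.

Section order.
Context (R : realType).

(** Two members of [V] with the same preimage are counted once on the left and
    twice on the right; hence an inequality, even when [f] is injective. *)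
Lemma ord_at_preimage_le (X Y : Type) (f : X -> Y) (V : set (set Y)) (x : X) :
  finite_set V ->
  ord_at R (preimage f @` V) x <= ord_at R V (f x).
Proof.
move=> finV; rewrite /ord_at lerD2l.
rewrite !fsbig_finite//; last exact: finite_image.
rewrite fset_set_image// (partition_big_imfset _ (preimage f) (fset_set V)) /=.
rewrite [leLHS]big_seq_cond [leRHS]big_seq_cond.
apply: ler_sum => B; rewrite andbT => /imfsetP[A /= AV ->].
(* among the members of V with preimage B, keep only A *)
rewrite big_mkcond (big_fsetD1 A)//= eqxx.
by rewrite -[leLHS]/(\1_A (f x)) lerDl sumr_ge0// => C _; case: ifP.
Qed.

(** Covering compensates the [-1], so that integrals of the order can be
    compared and transported as integrals of nonnegative functions. *)
Lemma ord_at_ge0 (X : topologicalType) (V : set (set X)) (x : X) :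
  Cov V -> 0 <= ord_at R V x.
Proof.
move=> [finV _ covV]; rewrite /ord_at addrC subr_ge0 fsbig_finite//.
have [A VA Ax] : (\bigcup_(A in V) A) x by rewrite covV.
rewrite (big_fsetD1 A)/=; last by rewrite in_fset_set// inE.
by rewrite indicE mem_set// lerDl sumr_ge0.
Qed.

Lemma measurable_ord_at (X : topologicalType) (h : $|X|) (V : set (set X)) :
  Cov V -> measurable_fun [set: borel h] (fun x : borel h => (ord_at R V x)%:E).
Proof.
move=> [finV oV _]; apply/measurable_EFinP.
apply: measurable_funD; first exact: measurable_cst.
(* the membership test is moved into the summand, so that every term is
   measurable, whether or not its index belongs to V *)
under eq_fun do rewrite fsbig_finite// big_seq big_mkcond.
apply: measurable_sum => A; case: (boolP (A \in fset_set V)) => [|_]; last exact: measurable_cst.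
rewrite in_fset_set// inE => VA; apply: measurable_indic.
by apply: sub_sigma_algebra; exact: oV.
Qed.

End order.

Section pullback.
Context (R : realType) (X Y : topologicalType) (f : continuousType X Y).

Lemma Cov_preimage (V : set (set Y)) : Cov V -> Cov (preimage f @` V).
Proof.
move=> [finV oV covV]; split.
- exact: finite_image.
- by move=> _ [B VB <-]; apply: open_comp (oV _ VB) => x _; exact: cts_fun.
- apply/seteqP; split=> // x _.
  have [B VB Bfx] : (\bigcup_(B in V) B) (f x) by rewrite covV.
  by exists (f @^-1` B) => //; exists B.
Qed.

Lemma ord_prob_preimage_le (P : set (Prob R X)) (Q : set (Prob R Y))
    (V : set (set Y)) :
  push f @` P `<=` Q -> Cov V ->
  (ord_prob (preimage f @` V) P <= ord_prob V Q)%E.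
Proof.
move=> PQ covV; apply: ge_ereal_sup => _ [mu Pmu <-].
apply: (@le_trans _ _ (\int[law (push f mu)]_y (ord_at R V y)%:E)%E); last first.
  by apply: ereal_sup_ubound; exists (push f mu) => //; apply: PQ; exists mu.
have V_ge0 y : (0 <= (ord_at R V y)%:E)%E by rewrite lee_fin ord_at_ge0.
have := @measurable_ord_at R _ (push_inh f (prob_inh mu)) _ covV.
move=> mV; rewrite /= ge0_integral_distribution//.
apply: ge0_le_integral => //.
- by move=> x _; rewrite lee_fin ord_at_ge0//; exact: Cov_preimage.
- apply: (@measurable_ord_at R X (prob_inh mu)); exact: Cov_preimage.
- by apply: measurableT_comp mV _; exact: borel_map_measurable.
- by move=> x _; rewrite lee_fin ord_at_preimage_le//; case: covV.
Qed.

(** Each [A \in U] is the preimage of an open set of [Y] with trace [f @` A] on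
    the range, by injectivity; closedness of the range allows its complement as
    one more member of [W].  The point of [X] makes [U] nonempty, so that some
    member of [U] contains the empty preimages produced by that complement. *)
Lemma extend_cover (U : set (set X)) :
  $|X| -> closed (range f) -> topological_embedding f -> Cov U ->
  exists2 W : set (set Y), Cov W &
    forall V, refines V W -> refines (preimage f @` V) U.
Proof.
move=> [x0] clf [injf _ embf] [finU oU covU].
(* outside U the value set0 is a default *)
have /choice[b bP] (A : set X) : exists B : set Y,
    U A -> open B /\ f @` A = B `&` range f.
  have [/oU/embf[B oB fAB]|nUA] := pselect (U A); first by exists B.
  by exists set0.
exists (b @` U `|` [set ~` range f]).
  split.
  - by rewrite finite_setU; split; [exact: finite_image|exact: finite_set1].
  - move=> _ [[A UA <-]|->]; first by case: (bP A UA).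
    exact: closed_openC.
  - apply/seteqP; split=> // y _.
    have [[x _ xy]|nfy] := pselect (range f y); last first.
      by exists (~` range f) => //; right.
    have [A UA Ax] : (\bigcup_(A in U) A) x by rewrite covU.
    exists (b A); first by left; exists A.
    have : (f @` A) y by exists x.
    by rewrite (bP A UA).2 => -[].
move=> V VW _ [B /VW[C WC BC] <-].
case: WC BC => [[A UA <-] BA|-> BC].
  exists A => // x /BA bAfx.
  have : (b A `&` range f) (f x) by split=> //; exists x.
  by rewrite -(bP A UA).2 => -[x' Ax' /injf <-].
have [A UA _] : (\bigcup_(A in U) A) x0 by rewrite covU.
by exists A => // x /BC; case; exists x.
Qed.

(** The witnesses that [X] is inhabited may differ, but they are proofs of a
    proposition, so equality of the set functions suffices. *)
Lemma pushK (g : continuousType Y X) : cancel f g ->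
  cancel (@push R _ _ f) (@push R _ _ g).
Proof.
move=> fK [h mu]; rewrite /push /=.
move: (push_inh g _) => h'; have hh' := Prop_irrelevance h' h.
subst h'; congr MkProb.
by apply/probability_ext/funext => A; congr (mu _); apply/seteqP;
  split=> x /=; rewrite /borel_map fK.
Qed.

End pullback.

Lemma homeomorphism_embedding (S T : topologicalType) (f : S -> T) :
  homeomorphism f -> topological_embedding f.
Proof.
move=> [ctsf [g [ctsg fK gK]]]; split=> //; first exact: can_inj fK.
move=> A oA; exists (g @^-1` A).
  by apply: open_comp oA => y _; exact: ctsg.
apply/seteqP; split=> [_ [x Ax <-]|y /= [Agy [x _ fxy]]].
  by split; [rewrite /= fK|exists x].
by exists x; [rewrite -fxy fK in Agy|].
Qed.

Lemma tm_dim_le (R : realType) (X Y : tmpair R) :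
  tm_embeds X Y -> (tm_dim X <= tm_dim Y)%E.
Proof.
move=> [f [fPQ embf]]; rewrite /tm_dim.
have [_|/set0P[mu Pmu]] := eqVneq (tm_prob X) set0; first exact: leNye.
have [Q0|_] := eqVneq (tm_prob Y) set0.
  have : tm_prob Y (push f mu) by apply: fPQ; exists mu.
  by rewrite Q0.
have clf : closed (range f).
  apply: compact_closed; first exact: metric_hausdorff.
  apply: continuous_compact (@tm_compact _ X).
  by apply: continuous_subspaceT => x; exact: cts_fun.
apply: ge_ereal_sup => _ [U covU <-].
have [W covW WU] := extend_cover (prob_inh mu) clf embf covU.
apply: (@le_trans _ _ (dim_cover W (tm_prob Y))); last first.
  by apply: ereal_sup_ubound; exists W.
apply: le_ereal_inf_tmp => _ [V [covV VW] <-].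
apply: le_trans (ord_prob_preimage_le fPQ covV).
apply: ereal_inf_lbound; exists (preimage f @` V) => //.
by split; [exact: Cov_preimage|exact: WU].
Qed.

Lemma tm_isomorphic_embeds (R : realType) (X Y : tmpair R) :
  tm_isomorphic X Y -> tm_embeds X Y.
Proof.
by move=> [f [fPQ homf _]]; exists f; split=> //; exact: homeomorphism_embedding.
Qed.

Lemma tm_isomorphic_sym (R : realType) (X Y : tmpair R) :
  tm_isomorphic X Y -> tm_isomorphic Y X.
Proof.
move=> [f [fPQ [ctsf [g0 [ctsg fK gK]]] fP]].
pose g : continuousType Y X := mkcts ctsg.
have gQ : push g @` tm_prob Y = tm_prob X.
  have pK := @pushK R _ _ f g fK.
  rewrite -fP; apply/seteqP; split=> [_ [_ [mu Pmu <-] <-]|mu Pmu].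
    by rewrite pK.
  by exists (push f mu); [exists mu|exact: pK].
exists g; split=> //; first by rewrite /tm_morphism gQ.
by split=> //; exists f.
Qed.

Theorem proposition3p1 : forall (R : realType) (X Y : tmpair R),
  (tm_embeds X Y -> (tm_dim X <= tm_dim Y)%E) /\
  (tm_isomorphic X Y -> tm_dim X = tm_dim Y).
Proof.
move=> R X Y; split=> [|isoXY]; first exact: tm_dim_le.
apply/le_anti/andP; split; apply/tm_dim_le/tm_isomorphic_embeds => //.
exact: tm_isomorphic_sym.
Qed.
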